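(* Let $p,q\in(1,\infty)$. Then \[\frac{\pi_{p,q}}{2}=\prod_{n=1}^\infty\left(1-\frac{1}{pn\,(qn+1-q/p)}\right)^{-1}.\]
   Context: For $p,q\in(1,\infty)$, $\pi_{p,q}:=2\int_0^1\frac{dt}{(1-t^q)^{1/p}}$. *)

(* Defs.v *)
From mathcomp Require Import all_boot all_order all_algebra.
From mathcomp Require Import all_classical all_reals all_analysis.

Set Implicit Arguments.
Unset Strict Implicit.
Unset Printing Implicit Defensive.

Import Order.TTheory GRing.Theory Num.Theory.
Import numFieldNormedType.Exports.

Local Open Scope classical_set_scope.
Local Open Scope ring_scope.

(* The integrand blows up at t = 1; there the total inverse gives it the value
   0, which does not affect the Lebesgue integral. *)
Definition pi_pq (R : realType) (p q : R) : R :=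
  2 * \int[@lebesgue_measure R]_(t in `[0, 1]) (1 / (1 - t `^ q) `^ (1 / p)).

(* Main.v *)
(* Write J c for the integral of (1 - t^q)^c over [0, 1].  Integrating the
   derivative of t (1 - t^q)^c gives q c J(c - 1) = (1 + q c) J(c) for c > 0.
   With b = 1/p this turns the N-th partial product into
   J(-b) * J(N) / J(N - b), and J(-b) = pi_pq p q / 2.  Since J is
   nonincreasing, J(N) <= J(N - b) <= J(N - 1) = (1 + 1/(q N)) J(N), so the
   quotient tends to 1. *)

Require Import Defs.
From mathcomp Require Import all_boot all_order all_algebra.
From mathcomp Require Import all_classical all_reals all_analysis.
From mathcomp Require Import measurable_realfun ring lra.

Set Implicit Arguments.
Unset Strict Implicit.
Unset Printing Implicit Defensive.

Import Order.TTheory GRing.Theory Num.Theory.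
Import numFieldNormedType.Exports.

Local Open Scope classical_set_scope.
Local Open Scope ring_scope.

(** * The kernel (1 - t^q)^c on the unit interval *)

Definition beta_kernel (R : realType) (q c t : R) : R := (1 - t `^ q) `^ c.

(* Equals B(1/q, c + 1) / q, by the substitution u = t^q. *)
Definition beta_integral (R : realType) (q c : R) : R :=
  \int[@lebesgue_measure R]_(t in `[0, 1]) beta_kernel q c t.

Lemma continuous_powR (R : realType) (c x : R) :
  0 < x -> {for x, continuous (@powR R ^~ c)}.
Proof.
move=> x0; apply/differentiable_continuous/derivable1_diffP.
by apply: derivable_powR; rewrite in_itv/= x0.
Qed.

Lemma powR_lt1 (R : realType) (q x : R) : 0 < q -> 0 <= x < 1 -> x `^ q < 1.
Proof.
move=> q0 /andP[x0 x1]; have :=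
  gt0_ltr_powR q0 (x0 : x \is Num.nneg) (ler01 : 1 \is Num.nneg) x1.
by rewrite powR1.
Qed.

Lemma beta_kernel_base (R : realType) (q t : R) :
  0 < q -> 0 <= t <= 1 -> 0 <= 1 - t `^ q <= 1.
Proof.
move=> q0 /andP[t0 t1]; rewrite subr_ge0 lerBlDr lerDl powR_ge0 andbT.
have := ge0_ler_powR (ltW q0) (t0 : t \is Num.nneg) (ler01 : 1 \is Num.nneg) t1.
by rewrite powR1.
Qed.

Lemma beta_kernel_ge0 (R : realType) (q c t : R) : 0 <= beta_kernel q c t.
Proof. exact: powR_ge0. Qed.

Lemma beta_kernel_nincr (R : realType) (q c d t : R) : 0 < q -> 0 <= t <= 1 ->
  0 <= c -> c <= d -> beta_kernel q d t <= beta_kernel q c t.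
Proof.
move=> q0 t01 c0 cd; rewrite /beta_kernel.
have /andP[] := beta_kernel_base q0 t01; set y := 1 - _.
rewrite le_eqVlt => /predU1P[<-|y0] y1; last by apply: ger_powR => //; rewrite y0.
(* Base 0 is the point t = 1. A power of 0 is 0 unless the exponent is 0, so only d = 0 is delicate,
   and it forces c = 0. *)
have [d0|d0] := eqVneq d 0; last by rewrite powR0 // powR_ge0.
by rewrite d0 (_ : c = 0) //; apply: le_anti; rewrite c0 andbT -d0.
Qed.

(** The product rule gives (1 - t^q)^c - q c t^q (1 - t^q)^(c-1); writing t^q = 1 - (1 - t^q) leaves
    only kernels of exponents c and c - 1. *)
Lemma is_derive_beta_kernelM (R : realType) (q c x : R) : 0 < q -> 0 < x < 1 ->
  is_derive x 1 (fun t => t * beta_kernel q c t)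
    ((1 + q * c) * beta_kernel q c x - q * c * beta_kernel q (c - 1) x).
Proof.
move=> q0 /andP[x0 x1]; rewrite /beta_kernel.
have y0 : 0 < 1 - x `^ q by rewrite subr_gt0 powR_lt1 // (ltW x0).
pose u : R -> R := fun t => 1 - t `^ q.
have du : is_derive x 1 u (- (q * x `^ (q - 1))).
  rewrite -[X in is_derive _ _ _ X]sub0r; apply: is_deriveB.
  exact: is_derive1_powR.
have dk : is_derive x 1 ((@powR R ^~ c) \o u)
    (c * (u x) `^ (c - 1) * (- (q * x `^ (q - 1)))).
  by apply: is_derive1_comp; apply: is_derive1_powR.
apply: (is_derive_eq (is_deriveM (is_derive_id x 1) dk)).
rewrite /= !scaler1 /GRing.scale /= -/(u x).
have -> : u x `^ c = u x * u x `^ (c - 1).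
  rewrite mulrC -[X in _ * X]powRr1 ?ltW // -powRD ?subrK //.
  by rewrite (gt_eqF y0) implybT.
have xq : x * x `^ (q - 1) = x `^ q by rewrite mulr_powRB1 // ltW.
set U := u x `^ (c - 1).
have -> : u x = 1 - x * x `^ (q - 1) by rewrite xq. ring.
Qed.

(** Stopping at x < 1 keeps the base 1 - t^q positive, so the exponent c may be negative. *)
Lemma beta_kernel_continuous (R : realType) (q c x : R) : 0 < q -> 0 < x < 1 ->
  {within `[0, x], continuous (beta_kernel q c)}.
Proof.
move=> q0 /andP[x0 x1].
(* The power t^q is differentiable at t > 0; the endpoint 0 is covered by the right-hand limit. *)
have : {within `[0, x], continuous (@powR R ^~ q)}.
  apply: derivable_oo_LRcontinuous_within; split.
  - move=> t; rewrite in_itv/= => /andP[t0 _].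
    by apply: derivable_powR; rewrite in_itv/= t0.
  - by rewrite powR0 ?gt_eqF //; exact: powR_cvg0.
  - by apply: cvg_at_left_filter; exact: continuous_powR.
move=> /subspace_continuousP cq; apply/subspace_continuousP => t tx.
move: (tx); rewrite /= in_itv/= => /andP[t0 tx'].
apply: (@cvg_comp _ _ _ (fun t => 1 - t `^ q) (@powR R ^~ c) _ (nbhs (1 - t `^ q))).
  by apply: cvgB; [exact: cvg_cst | exact: cq].
by apply: continuous_powR; rewrite subr_gt0 powR_lt1 // t0 (le_lt_trans tx').
Qed.

Lemma measurable_beta_kernel (R : realType) (q c : R) (D : set R) :
  measurable_fun D (beta_kernel q c).
Proof.
apply: measurable_funTS; apply: measurableT_comp (measurable_powR c) _.
by apply: measurable_funB => //; exact: measurable_powR.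
Qed.

(** For c >= 0 the kernel is dominated by 1, its value at exponent 0. *)
Lemma integrable_beta_kernel (R : realType) (q c : R) : 0 < q -> 0 <= c ->
  (@lebesgue_measure R).-integrable `[0, 1] (EFin \o beta_kernel q c).
Proof.
move=> q0 c0; apply: (@le_integrable _ _ _ _ _ _ _ (EFin \o cst 1)) => //.
- by apply/measurable_EFinP; exact: measurable_beta_kernel.
- move=> t /=; rewrite in_itv/= => t01.
  rewrite lee_fin normr1 ger0_norm ?beta_kernel_ge0 //.
  by have := beta_kernel_nincr q0 t01 (lexx 0) c0; rewrite {2}/beta_kernel powRr0.
- apply: continuous_compact_integrable; first exact: segment_compact.
  by apply: continuous_subspaceT; exact: cst_continuous.
Qed.

(** * The integral: recurrence in the exponent, monotonicity, value at 0 *)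

Lemma within_continuousM (T : topologicalType) (K : numFieldType) (A : set T)
    (f g : T -> K) :
  {within A, continuous f} -> {within A, continuous g} ->
  {within A, continuous (fun t => f t * g t)}.
Proof. by move=> cf cg x; apply: cvgM; [exact: cf|exact: cg]. Qed.

(** The derivative of t (1 - t^q)^c is integrated; the boundary term at 0 vanishes through the
    factor t, and x < 1 keeps the kernel of exponent c - 1 continuous. *)
Lemma beta_integral_FTC (R : realType) (q c x : R) : 0 < q -> 0 < x < 1 ->
  (1 + q * c) * \int[@lebesgue_measure R]_(t in `[0, x]) beta_kernel q c t
  - q * c * \int[@lebesgue_measure R]_(t in `[0, x]) beta_kernel q (c - 1) t
  = x * beta_kernel q c x.
Proof.
move=> q0 x01; have [x0 x1] := andP x01.
have ck d : {within `[0, x], continuous (beta_kernel q d)}.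
  exact: beta_kernel_continuous.
have ik d : (@lebesgue_measure R).-integrable `[0, x] (EFin \o beta_kernel q d).
  by apply: continuous_compact_integrable; [exact: segment_compact|exact: ck].
pose F t := t * beta_kernel q c t.
pose f t := (1 + q * c) * beta_kernel q c t - q * c * beta_kernel q (c - 1) t.
have dF t : t \in `]0, x[ -> is_derive t 1 F (f t).
  rewrite in_itv/= => /andP[t0 tx].
  by apply: is_derive_beta_kernelM; rewrite // t0 (lt_trans tx).
have cid : {within `[0, x], continuous (@id R)}.
  by apply: continuous_subspaceT => t; exact: cvg_id.
have cst_c (a : R) : {within `[0, x], continuous (fun=> a : R)}.
  by apply: continuous_subspaceT; exact: cst_continuous.
have cf : {within `[0, x], continuous f}.
  exact: (within_continuousB (within_continuousM (cst_c _) (ck _))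
                             (within_continuousM (cst_c _) (ck _))).
have cF : {within `[0, x], continuous F} := within_continuousM cid (ck c).
have [_ F0 Fx] := (continuous_within_itvP F x0).1 cF.
have FF : derivable_oo_LRcontinuous F 0 x.
  by split; [move=> t /dF dFt; case: dFt|exact: F0|exact: Fx].
have F'f : {in `]0, x[, F^`()%classic =1 f}.
  by move=> t /dF [_ <-]; rewrite derive1E.
have /(congr1 fine) := continuous_FTC2 x0 cf FF F'f.
rewrite -EFinB /= {2}/F mul0r subr0 => FxE.
rewrite -/(F x) -FxE.
transitivity (\int[@lebesgue_measure R]_(t in `[0, x]) f t); last by [].
rewrite /f RintegralB //; last 2 first.
- exact: (integrableZl _ (1 + q * c) (ik c)).
- exact: (integrableZl _ (q * c) (ik (c - 1))).
by rewrite !RintegralZl.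
Qed.

(** Monotone convergence along segments exhausting [0, 1[. The limit lives in the extended reals
    because for c < 0 integrability is not known beforehand. *)
Lemma cvg_truncated_integral (R : realType) (q c : R) :
  (\int[@lebesgue_measure R]_(t in `[0%R, (1 - n.+2%:R^-1)%R])
     (beta_kernel q c t)%:E)%E @[n --> \oo] -->
  (\int[@lebesgue_measure R]_(t in `[0%R, 1%R]) (beta_kernel q c t)%:E)%E.
Proof.
pose x n : R := 1 - n.+2%:R^-1.
pose F n := `[0, x n]%classic : set R.
rewrite -integral_itv_bndo_bndc; last first.
  by apply/measurable_EFinP; exact: measurable_beta_kernel.
rewrite (_ : [set` `[0%R, 1%R[] = \bigcup_n F n); last first.
  apply/seteqP; split => t /=.
    rewrite in_itv/= => /andP[t0 t1].
    have y0 : 0 <= (1 - t)^-1 by rewrite invr_ge0 subr_ge0 ltW.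
    (* The condition t <= 1 - 1/(n+2) amounts to 1/(1 - t) <= n + 2. *)
    exists (Num.bound (1 - t)^-1) => //=; rewrite /F /x /= in_itv/= t0 /=.
    rewrite lerBrDr addrC -lerBrDr -[leRHS]invrK lef_pV2 ?posrE ?invr_gt0 ?subr_gt0 //.
    by rewrite (le_trans (ltW (archi_boundP y0))) // ler_nat -addn2 leq_addr.
  rewrite in_itv/= => -[n _]; rewrite /F /x /= in_itv/= => /andP[-> /le_lt_trans]; apply.
  by rewrite ltrBlDr ltrDl invr_gt0.
have ndF : nondecreasing_seq F.
  move=> m n mn; apply/subsetPset => t; rewrite /F /x /= !in_itv/=.
  move=> /andP[-> /le_trans]; apply.
  by rewrite lerB // lef_pV2 ?posrE ?ltr0n // ler_nat.
have mk n : measurable_fun (F n) (EFin \o beta_kernel q c).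
  by apply/measurable_EFinP; exact: measurable_beta_kernel.
have k0 n t : F n t -> (0 <= (EFin \o beta_kernel q c) t)%E.
  by move=> _; rewrite lee_fin beta_kernel_ge0.
exact: (ge0_nondecreasing_set_cvg_integral (mu := @lebesgue_measure R) ndF
  (fun n => measurable_itv _) mk k0).
Qed.

(** The base 1 - t^q decreases to 0 as t increases to 1, and y^c tends to 0 as y decreases to 0. *)
Lemma cvg_beta_kernel_at1 (R : realType) (q c : R) : 0 < q -> 0 < c ->
  beta_kernel q c t @[t --> 1^'-] --> 0.
Proof.
move=> q0 c0.
apply: (@decreasing_cvg_at_left_comp _ (fun t => 1 - t `^ q) (@powR R ^~ c) (BLeft 0)).
- by rewrite bnd_simp.
- move=> s t; rewrite !in_itv/= => /andP[s0 _] /andP[t0 _] ts.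
  by rewrite ltrD2l ltrN2; apply: gt0_ltr_powR.
- apply: cvgB; first exact: cvg_cst.
  apply: cvg_at_left_filter.
  exact: continuous_powR.
- by rewrite powR1 subrr; exact: powR_cvg0.
Qed.

(* For c < 1 the integrand of the left-hand side is unbounded near 1, so the
   identity is first obtained on [0, 1 - 1/(n+2)] and then passed to the limit
   by monotone convergence. *)
Lemma beta_integral_recurrence (R : realType) (q c : R) : 0 < q -> 0 < c ->
  q * c * beta_integral q (c - 1) = (1 + q * c) * beta_integral q c.
Proof.
move=> q0 c0; have qc0 : q * c != 0 by rewrite mulf_neq0 ?gt_eqF.
(* With n + 2 rather than n + 1 the endpoint is positive already at n = 0. *)
pose x n : R := 1 - n.+2%:R^-1.
pose I d n := \int[@lebesgue_measure R]_(t in `[0, x n]) beta_kernel q d t.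
have x01 n : 0 < x n < 1.
  by rewrite subr_gt0 invf_lt1 ?ltr0n // ltr1n /= ltrBlDr ltrDl invr_gt0.
have IE d n : (I d n)%:E =
    (\int[@lebesgue_measure R]_(t in `[0%R, x n]) (beta_kernel q d t)%:E)%E.
  rewrite fineK //; apply: integrable_fin_num => //.
  apply: continuous_compact_integrable; first exact: segment_compact.
  exact: beta_kernel_continuous.
have cvgE d : (fun n => (I d n)%:E) @ \oo -->
    (\int[@lebesgue_measure R]_(t in `[0%R, 1%R]) (beta_kernel q d t)%:E)%E.
  by under eq_fun do rewrite IE; exact: cvg_truncated_integral.
have cvgI : I c @ \oo --> beta_integral q c.
  apply: (fine_cvg (f := fun n => (I c n)%:E)).
  rewrite /beta_integral /Rintegral fineK; first exact: cvgE.
  exact: integrable_fin_num (integrable_beta_kernel q0 (ltW c0)).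
have cvgx : x @ \oo --> (1 : R).
  rewrite -[X in _ --> X]subr0; apply: cvgB; first exact: cvg_cst.
  have : [sequence @harmonic R (n + 1)%N]_n @ \oo --> (0 : R).
    by rewrite cvg_shiftn; exact: cvg_harmonic.
  by under eq_fun do rewrite /harmonic /= addn1.
have cvgk : (fun n => x n * beta_kernel q c (x n)) @ \oo --> (0 : R).
  rewrite -[X in _ --> X](mulr0 1); apply: cvgM => //.
  apply: ((cvg_at_leftP _ _ _).1 (cvg_beta_kernel_at1 q0 c0)).
  by split => // n; case/andP: (x01 n).
set L := (1 + q * c) * beta_integral q c.
(* The truncated identity, solved for the integral of exponent c - 1, has a finite limit. *)
have cvgI1 : I (c - 1) @ \oo --> (q * c)^-1 * (L - 0).
  have -> : I (c - 1) = fun n =>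
      (q * c)^-1 * ((1 + q * c) * I c n - x n * beta_kernel q c (x n)).
    apply/funext => n; rewrite -beta_integral_FTC // -/(I c n) -/(I (c - 1) n).
    by rewrite subKr mulKf.
  apply: cvgM; first exact: cvg_cst.
  by apply: cvgB => //; apply: cvgM => //; exact: cvg_cst.
have cvgI1E : (fun n => (I (c - 1) n)%:E) @ \oo --> ((q * c)^-1 * (L - 0))%:E.
  by apply: cvg_EFin => //; exact: nearW.
(* Uniqueness of the limit in the extended reals shows that the integral of exponent c - 1 is
   finite, so its real part in [beta_integral] is the true value. *)
have := cvg_lim (@ereal_hausdorff R) (cvgE (c - 1)).
rewrite (cvg_lim (@ereal_hausdorff R) cvgI1E) => IE1.
by rewrite /beta_integral /Rintegral -IE1 /= subr0 mulVKf.
Qed.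

Lemma beta_integral_le (R : realType) (q c d : R) : 0 < q -> 0 <= c -> c <= d ->
  beta_integral q d <= beta_integral q c.
Proof.
move=> q0 c0 cd; apply: le_Rintegral => //.
- exact: integrable_beta_kernel (le_trans c0 cd).
- exact: integrable_beta_kernel.
- by move=> t /=; rewrite in_itv/= => t01; exact: beta_kernel_nincr.
Qed.

Lemma beta_integral0 (R : realType) (q : R) : beta_integral q 0 = 1.
Proof.
rewrite /beta_integral /beta_kernel; under eq_Rintegral do rewrite powRr0.
rewrite Rintegral_cst // mul1r /= lebesgue_measure_itv /= lte_fin ltr01.
by rewrite -EFinB subr0.
Qed.

(** * Algebra of the recurrence: positivity and telescoping *)

Lemma recurrence_nat_gt0 (F : realFieldType) (q : F) (J : F -> F) (n : nat) :
  0 < q -> J 0 = 1 ->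
  (forall c, 0 < c -> q * c * J (c - 1) = (1 + q * c) * J c) -> 0 < J n%:R.
Proof.
move=> q0 J0 rec; elim: n => [|n IH]; first by rewrite J0.
have n0 : 0 < n.+1%:R :> F by rewrite ltr0n.
have qn0 : 0 < q * n.+1%:R by rewrite mulr_gt0.
have := rec _ n0; rewrite -[in J (_ - 1)]natr1 addrK => e.
by rewrite -(@pmulr_rgt0 _ (1 + q * n.+1%:R)) -?e ?mulr_gt0 // addr_gt0.
Qed.

(** With b = 1/p, the recurrence at n and at n - b turns the n-th factor into J(n)/J(n-1) times
    J(n-1-b)/J(n-b), and the product telescopes. The identity is multiplied out because an arbitrary
    solution J may vanish. *)
Lemma recurrence_prod (F : realFieldType) (p q : F) (J : F -> F) (N : nat) :
  1 < p -> 0 < q -> J 0 = 1 ->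
  (forall c, 0 < c -> q * c * J (c - 1) = (1 + q * c) * J c) ->
  \prod_(1 <= n < N.+1) (1 - 1 / (p * n%:R * (q * n%:R + 1 - q / p)))^-1 *
  J (N%:R - 1 / p) = J (- (1 / p)) * J N%:R.
Proof.
move=> p1 q0 J0 rec; have p0 : 0 < p := lt_trans ltr01 p1.
elim: N => [|N IH]; first by rewrite big_geq // mul1r sub0r J0 mulr1.
rewrite big_nat_recr //=.
set P := \prod_(_ <= _ < _) _ in IH *.
have Nn : N%:R = N.+1%:R - 1 :> F by rewrite -natr1 addrK.
have n0 : 0 < N.+1%:R :> F by rewrite ltr0n.
have n1 : 1 <= N.+1%:R :> F by rewrite ler1n.
move: (N.+1%:R) Nn n0 n1 => n Nn n0 n1.
have b1 : 1 / p < 1 by rewrite ltr_pdivrMr // mul1r.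
have c0 : 0 < n - 1 / p by rewrite subr_gt0 (lt_le_trans b1).
have rn := rec _ n0; have rc := rec _ c0.
rewrite (_ : n - 1 / p - 1 = N%:R - 1 / p) in rc; last by rewrite Nn addrAC.
rewrite -Nn in rn.
have qn0 : q * n != 0 by rewrite gt_eqF // mulr_gt0.
have qc0 : q * (n - 1 / p) != 0 by rewrite gt_eqF // mulr_gt0.
have dn0 : 1 + q * n != 0 by rewrite gt_eqF // addr_gt0 // mulr_gt0.
have dc0 : 1 + q * (n - 1 / p) != 0 by rewrite gt_eqF // addr_gt0 // mulr_gt0.
have -> : 1 - 1 / (p * n * (q * n + 1 - q / p)) =
    (1 + q * n) * (q * (n - 1 / p)) / (q * n * (1 + q * (n - 1 / p))).
  rewrite (_ : q * n + 1 - q / p = 1 + q * (n - 1 / p)); last by ring.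
  apply: (mulIf (mulf_neq0 qn0 dc0)); rewrite (divfK (mulf_neq0 qn0 dc0)).
  move: dc0; set D := 1 + q * (n - 1 / p) => dc0.
  have -> : (1 - 1 / (p * n * D)) * (q * n * D) = q * n * D - q / p.
    by field; rewrite dc0 !gt_eqF.
  by rewrite /D; ring.
have JN : J N%:R = (1 + q * n) / (q * n) * J n.
  by rewrite -[LHS](mulKf qn0) rn mulrA [_^-1 * _]mulrC.
have JNb : J (N%:R - 1 / p) = (1 + q * (n - 1 / p)) /
    (q * (n - 1 / p)) * J (n - 1 / p).
  by rewrite -[LHS](mulKf qc0) rc mulrA [_^-1 * _]mulrC.
move: IH; rewrite JN JNb => IH.
(* Scaling by (1 + q n)/(q n) makes the expanded J(N) appear on the right, where the induction
   hypothesis applies. *)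
apply: (mulfI (mulf_neq0 dn0 (invr_neq0 qn0))).
rewrite [RHS]mulrCA -IH.
move: (q * (n - 1 / p)) (q * n) qn0 qc0 dn0 dc0 => y x x0 y0 dx0 dy0.
by field; rewrite ?x0 ?y0 ?dx0 ?dy0.
Qed.

(** * Convergence of the partial products *)

Theorem theorem3p9 (R : realType) (p q : R) (hp : 1 < p) (hq : 1 < q) :
  (fun N : nat => \prod_(1 <= n < N.+1)
     (1 - 1 / (p * n%:R * (q * n%:R + 1 - q / p)))^-1) @ \oo
  --> pi_pq p q / 2.
Proof.
have p0 : 0 < p := lt_trans ltr01 hp.
have q0 : 0 < q := lt_trans ltr01 hq.
have b0 : 0 < 1 / p by rewrite divr_gt0.
have b1 : 1 / p < 1 by rewrite ltr_pdivrMr // mul1r.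
have -> : pi_pq p q / 2 = beta_integral q (- (1 / p)).
  rewrite /pi_pq mulrC mulKf ?pnatr_eq0 // /beta_integral.
  (* The integrands agree even at t = 1, where both are 0 by convention. *)
  by apply: eq_Rintegral => t _; rewrite /beta_kernel powRN div1r.
have J0 := beta_integral0 q.
have rec c := @beta_integral_recurrence _ _ c q0.
have J_gt0 (N : nat) : 0 < beta_integral q N%:R := recurrence_nat_gt0 N q0 J0 rec.
have Jb0 (N : nat) : 0 < beta_integral q (N.+1%:R - 1 / p).
  apply: lt_le_trans (J_gt0 N.+1) _.
  apply: beta_integral_le => //; last by rewrite gerBl ltW.
  by rewrite subr_ge0 (le_trans (ltW b1)) // ler1n.
(* The shift to N + 1 keeps the exponent N + 1 - 1/p nonnegative, as the monotonicity of the
   integral requires; at index 0 it would be -1/p. *)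
rewrite -(cvg_shiftS _) (_ : (fun N : nat => _) = (fun N : nat =>
    beta_integral q (- (1 / p)) *
    (beta_integral q N.+1%:R / beta_integral q (N.+1%:R - 1 / p)))); last first.
  apply/funext => N.
  by rewrite mulrA -(recurrence_prod _ hp q0 J0 rec) mulfK ?lt0r_neq0.
rewrite -[beta_integral q (- (1 / p)) in X in _ --> X]mulr1.
apply: cvgM; first exact: cvg_cst.
apply: (@squeeze_cvgr _ _ _ _ (fun N => 1 - harmonic N) (cst 1)); last first.
- exact: cvg_cst.
- by rewrite -[X in _ --> X]subr0; apply: cvgB; [exact: cvg_cst|exact: cvg_harmonic].
apply: nearW => N /=; apply/andP; split; last first.
  rewrite ler_pdivrMr ?Jb0 // [leRHS]mul1r; apply: beta_integral_le => //.
    by rewrite subr_ge0 (le_trans (ltW b1)) // ler1n.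
  by rewrite gerBl ltW.
rewrite ler_pdivlMr ?Jb0 //.
have rN := beta_integral_recurrence q0 (ltr0Sn R N).
have JN := J_gt0 N.
(* As 1/p < 1, the denominator is at most J(N), which the recurrence compares with J(N+1). *)
have JbN : beta_integral q (N.+1%:R - 1 / p) <= beta_integral q N%:R.
  by apply: beta_integral_le; rewrite // -natr1 -addrA lerDl subr_ge0 ltW.
apply: (@le_trans _ _ ((1 - N.+1%:R^-1) * beta_integral q N%:R)).
  by rewrite ler_wpM2l // subr_ge0 invf_le1 ?ltr0n // ler1n.
rewrite -[in beta_integral q (_ - 1)]natr1 addrK in rN.
have n0 : 0 < N.+1%:R :> R by rewrite ltr0n.
have qn0 : 0 < 1 + q * N.+1%:R by rewrite addr_gt0 // mulr_gt0.
rewrite -(ler_pM2l qn0) -rN mulrA ler_pM2r //.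
rewrite mulrBr mulr1 mulrDl mul1r mulfK ?lt0r_neq0 //.
have i0 : 0 < N.+1%:R^-1 :> R by rewrite invr_gt0.
(* Since x y = q, the claim (1 + x)(1 - y) <= x reads 1 <= y + q, which follows from q > 1 and y >
   0. *)
move: (q * N.+1%:R) (N.+1%:R^-1) i0 hq => x y y0 q1.
lra.
Qed.
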